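(* Let $\varepsilon\in\{1,-1\}$ and $n\ge1$. The element $d_{n,\varepsilon}$ is the unique element $x\in\mathrm{TL}(D_n)_\varepsilon$ such that $x$ is non-zero, $x$ is idempotent, $s_0xs_0=x$, and $xU_i=0=U_ix$ for all $i=0,1,\dots,n-1$.
   Context: The ground field is $k=\mathbb{C}(q)$. $\mathrm{TL}(B_n)_\varepsilon$ is the unital $k$-algebra with generators $s_0,U_1,\dots,U_{n-1}$ and relations $U_i^2=-\varepsilon(q+q^{-1})U_i$; $U_iU_j=U_jU_i$ for $|i-j|\ge2$; $U_iU_{i+1}U_i=U_i$, $U_{i+1}U_iU_{i+1}=U_{i+1}$ for $1\le i\le n-2$; $s_0^2=1$; $U_1s_0U_1=0$; $s_0U_i=U_is_0$ for $2\le i\le n-1$. For $n\ge2$ put $U_0=s_0U_1s_0$; $\mathrm{TL}(D_n)_\varepsilon\subset\mathrm{TL}(B_n)_\varepsilon$ is the unital subalgebra generated by $U_0,U_1,\dots,U_{n-1}$ (for $n=1$ there are no $U_i$ and $\mathrm{TL}(D_1)_\varepsilon=k$). $\mathrm{TL}(B_n)_\varepsilon$ is regarded as a subalgebra of $\mathrm{TL}(B_{n+1})_\varepsilon$ via the generators of the same name. For $\eta\in\{+,-\}$ (identified with $\pm1$), $b_{1,\eta,\varepsilon}=\frac12(1+\eta s_0)$ and $b_{n+1,\eta,\varepsilon}=b_{n,\eta,\varepsilon}+\varepsilon\frac{q^{n-1}+q^{-(n-1)}}{q^n+q^{-n}}b_{n,\eta,\varepsilon}U_nb_{n,\eta,\varepsilon}$.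 The type $D_n$ Jones--Wenzl projector is $d_{n,\varepsilon}=b_{n,+,\varepsilon}+b_{n,-,\varepsilon}$, and it lies in $\mathrm{TL}(D_n)_\varepsilon$. *)

(* Defs.v *)
From HB Require Import structures.
From mathcomp Require Import all_boot all_algebra.
From mathcomp Require Import boolp reals complex fraction generic_quotient.
From mathcomp Require Import zify.
From mathcomp.multinomials Require Import monalg.

Set Implicit Arguments.
Unset Strict Implicit.
Unset Printing Implicit Defensive.

Import GRing.Theory.
Local Open Scope ring_scope.
Local Open Scope quotient_scope.

(* the field of rational functions C(q), with C = R[i] *)
Definition Cq (R : realType) : fieldType := {fraction {poly R[i]}}.
Definition qvar (R : realType) : Cq R := tofrac 'X.

(* The defining relations of TL(B_n), for elements v 0 (playing the role of
   s_0) and v i (playing the role of U_i), 0 < i < n, of any algebra. *)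
Section TLBRel.
Variables (k : fieldType) (q eps : k) (n : nat) (A : lalgType k) (v : nat -> A).

Inductive TLB_rel : A -> A -> Prop :=
| TLB_relUU i of (0 < i < n)%N :
    TLB_rel (v i * v i) (- (eps * (q + q^-1)) *: v i)
| TLB_relUC i j of (0 < i < n)%N & (0 < j < n)%N
                 & (i.+2 <= j)%N || (j.+2 <= i)%N :
    TLB_rel (v i * v j) (v j * v i)
| TLB_relUSU i of (0 < i)%N & (i.+1 < n)%N :
    TLB_rel (v i * v i.+1 * v i) (v i)
| TLB_relSUS i of (0 < i)%N & (i.+1 < n)%N :
    TLB_rel (v i.+1 * v i * v i.+1) (v i.+1)
| TLB_relss : TLB_rel (v 0 * v 0) 1
| TLB_relUsU of (1 < n)%N :
    TLB_rel (v 1 * v 0 * v 1) 0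
| TLB_relsC i of (1 < i < n)%N :
    TLB_rel (v 0 * v i) (v i * v 0).

End TLBRel.

(* TL(B_n) is the free algebra on s_0, U_1, ..., U_(n-1) modulo the two-sided
   ideal generated by the relations. The letter of index 0 is s_0, that of index
   i, 0 < i < n, is U_i. The letter type 'I_n.-1.+1 is 'I_n when n > 0; only
   this case is meaningful (n = 0 yields the same algebra as n = 1). *)
Definition freeTLB (k : fieldType) (n : nat) := {malg k[{fmonom 'I_n.-1.+1}]}.
HB.instance Definition _ k n := GRing.Lalgebra.on (freeTLB k n).

HB.lock Definition gen (k : fieldType) (n i : nat) : freeTLB k n :=
  << fmu (inord i) >>.

Section TLB.
Variables (k : fieldType) (q eps : k) (n : nat).

Local Notation freeTLB := (freeTLB k n).

Inductive TLB_ideal : freeTLB -> Prop :=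
| TLB_ideal_rel a b of TLB_rel q eps n (gen k n) a b : TLB_ideal (a - b)
| TLB_ideal0 : TLB_ideal 0
| TLB_idealD x y of TLB_ideal x & TLB_ideal y : TLB_ideal (x + y)
| TLB_idealM a x b of TLB_ideal x : TLB_ideal (a * x * b).

Definition TLB_eqv (x y : freeTLB) : bool := `[< TLB_ideal (x - y) >].

Lemma TLB_idealN x : TLB_ideal x -> TLB_ideal (- x).
Proof. by move=> h; rewrite -mulN1r -[_ * _]mulr1; apply: TLB_idealM. Qed.

Lemma TLB_idealZ c x : TLB_ideal x -> TLB_ideal (c *: x).
Proof.
by move=> h; rewrite -[x]mul1r scalerAl -[_ * _]mulr1; apply: TLB_idealM.
Qed.

Lemma TLB_eqv_refl : reflexive TLB_eqv.
Proof. by move=> x; apply/asboolP; rewrite subrr; apply: TLB_ideal0. Qed.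

Lemma TLB_eqv_sym : symmetric TLB_eqv.
Proof.
by move=> x y; apply/asboolP/asboolP => /TLB_idealN; rewrite opprB.
Qed.

Lemma TLB_eqv_trans : transitive TLB_eqv.
Proof.
move=> y x z /asboolP h1 /asboolP h2; apply/asboolP.
by rewrite -(subrKA y); apply: TLB_idealD.
Qed.

Canonical TLB_equiv := EquivRel TLB_eqv TLB_eqv_refl TLB_eqv_sym TLB_eqv_trans.

Definition TLB := {eq_quot TLB_eqv}.
HB.instance Definition _ := Choice.on TLB.
HB.instance Definition _ := EqQuotient.on TLB.

Definition TLB_pi (x : freeTLB) : TLB := \pi_TLB x.

Lemma TLB_piP x y : TLB_pi x = TLB_pi y <-> TLB_ideal (x - y).
Proof.
split=> [/eqmodP /asboolP //|h]; by apply/eqmodP/asboolP.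
Qed.

Lemma TLB_piW (P : TLB -> Prop) : (forall a, P (TLB_pi a)) -> forall x, P x.
Proof. by move=> h; exact: quotW. Qed.

Lemma TLB_reprK x : TLB_pi (repr x) = x.
Proof. exact: reprK. Qed.

End TLB.

(* The operations are locked to keep unification from unfolding them. *)
HB.lock Definition TLB_add (k : fieldType) (q eps : k) (n : nat)
  (x y : TLB q eps n) : TLB q eps n := TLB_pi q eps (repr x + repr y).
HB.lock Definition TLB_opp (k : fieldType) (q eps : k) (n : nat)
  (x : TLB q eps n) : TLB q eps n := TLB_pi q eps (- repr x).
HB.lock Definition TLB_mul (k : fieldType) (q eps : k) (n : nat)
  (x y : TLB q eps n) : TLB q eps n := TLB_pi q eps (repr x * repr y).
HB.lock Definition TLB_scale (k : fieldType) (q eps : k) (n : nat)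
  (c : k) (x : TLB q eps n) : TLB q eps n := TLB_pi q eps (c *: repr x).

Section TLBZmod.
Variables (k : fieldType) (q eps : k) (n : nat).

Local Notation TLB := (TLB q eps n).
Local Notation TLB_pi := (@TLB_pi k q eps n).
Local Notation TLB_ideal := (@TLB_ideal k q eps n).
Local Notation TLB_add := (@TLB_add k q eps n).
Local Notation TLB_opp := (@TLB_opp k q eps n).
Local Notation TLB_mul := (@TLB_mul k q eps n).
Local Notation TLB_scale := (@TLB_scale k q eps n).

Lemma TLB_ideal_repr a : TLB_ideal (repr (TLB_pi a) - a).
Proof. by apply/TLB_piP; rewrite TLB_reprK. Qed.

Lemma TLB_pi_add a b : TLB_add (TLB_pi a) (TLB_pi b) = TLB_pi (a + b).
Proof.
by rewrite unlock; apply/TLB_piP; rewrite opprD addrACA; apply: TLB_idealD;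
   apply: TLB_ideal_repr.
Qed.

Lemma TLB_pi_opp a : TLB_opp (TLB_pi a) = TLB_pi (- a).
Proof.
rewrite unlock; apply/TLB_piP; rewrite -opprD.
by apply: TLB_idealN; apply: TLB_ideal_repr.
Qed.

Lemma TLB_pi_scale c a : TLB_scale c (TLB_pi a) = TLB_pi (c *: a).
Proof.
rewrite unlock; apply/TLB_piP; rewrite -scalerBr.
by apply: TLB_idealZ; apply: TLB_ideal_repr.
Qed.

Lemma TLB_pi_mul a b : TLB_mul (TLB_pi a) (TLB_pi b) = TLB_pi (a * b).
Proof.
rewrite unlock; apply/TLB_piP; set a' := repr _; set b' := repr _.
have -> : a' * b' - a * b = 1 * (a' - a) * b' + a * (b' - b) * 1.
  by rewrite mul1r mulr1 mulrBl mulrBr addrA subrK.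
by apply: TLB_idealD; apply: TLB_idealM; apply: TLB_ideal_repr.
Qed.

Lemma TLB_addA : associative TLB_add.
Proof.
elim/TLB_piW=> a; elim/TLB_piW=> b; elim/TLB_piW=> c.
by rewrite !TLB_pi_add addrA.
Qed.

Lemma TLB_addC : commutative TLB_add.
Proof.
by elim/TLB_piW=> a; elim/TLB_piW=> b; rewrite !TLB_pi_add addrC.
Qed.

Lemma TLB_add0 : left_id (TLB_pi 0) TLB_add.
Proof. by elim/TLB_piW=> a; rewrite TLB_pi_add add0r. Qed.

Lemma TLB_addN : left_inverse (TLB_pi 0) TLB_opp TLB_add.
Proof. by elim/TLB_piW=> a; rewrite TLB_pi_opp TLB_pi_add addNr. Qed.

HB.instance Definition _ :=
  GRing.isZmodule.Build TLB TLB_addA TLB_addC TLB_add0 TLB_addN.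

Lemma TLB_mulA : associative TLB_mul.
Proof.
elim/TLB_piW=> a; elim/TLB_piW=> b; elim/TLB_piW=> c.
by rewrite !TLB_pi_mul mulrA.
Qed.

Lemma TLB_mul1l : left_id (TLB_pi 1) TLB_mul.
Proof. by elim/TLB_piW=> a; rewrite TLB_pi_mul mul1r. Qed.

Lemma TLB_mul1r : right_id (TLB_pi 1) TLB_mul.
Proof. by elim/TLB_piW=> a; rewrite TLB_pi_mul mulr1. Qed.

Lemma TLB_mulDl : left_distributive TLB_mul +%R.
Proof.
elim/TLB_piW=> a; elim/TLB_piW=> b; elim/TLB_piW=> c.
by rewrite /GRing.add /= !(TLB_pi_mul, TLB_pi_add) mulrDl.
Qed.

Lemma TLB_mulDr : right_distributive TLB_mul +%R.
Proof.
elim/TLB_piW=> a; elim/TLB_piW=> b; elim/TLB_piW=> c.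
by rewrite /GRing.add /= !(TLB_pi_mul, TLB_pi_add) mulrDr.
Qed.

End TLBZmod.

(* Evaluation of the free algebra at a family of elements of an algebra. *)
Section Eval.
Variables (k : fieldType) (n : nat) (A : algType k) (v : nat -> A).

Definition word_eval (w : {fmonom 'I_n.-1.+1}) : A := \prod_(j <- (w : seq _)) v j.

Lemma word_eval_morph : mmorphism word_eval.
Proof.
split=> [x y|]; rewrite /word_eval; last by rewrite fm1 big_nil.
by rewrite fmM big_cat.
Qed.

HB.instance Definition _ := isMultiplicative.Build _ _ word_eval word_eval_morph.

Definition free_eval : freeTLB k n -> A := mmap (GRing.in_alg A) word_eval.

Lemma free_evalD x y : free_eval (x + y) = free_eval x + free_eval y.
Proof. exact: mmapD. Qed.

Lemma free_evalN x : free_eval (- x) = - free_eval x.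
Proof. exact: mmapN. Qed.

Lemma free_eval0 : free_eval 0 = 0.
Proof. exact: mmap0. Qed.

Lemma free_eval1 : free_eval 1 = 1.
Proof. exact: mmap1. Qed.

Lemma free_evalM x y : free_eval (x * y) = free_eval x * free_eval y.
Proof.
have [h _] : multiplicative free_eval.
  apply: commr_mmap_is_multiplicative => g m m' /=.
  by rewrite /GRing.comm -scalerAl -scalerAr mul1r mulr1.
exact: h.
Qed.

Lemma free_evalZ c x : free_eval (c *: x) = c *: free_eval x.
Proof. by rewrite /free_eval mmapZ /= mulr_algl. Qed.

Lemma free_eval_gen i : (i < n.-1.+1)%N -> free_eval (gen k n i) = v i.
Proof.
move=> lti; rewrite /free_eval unlock mmapU /= scale1r mul1r /word_eval.
by rewrite fmU big_seq1 inordK.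
Qed.

End Eval.

Section Quotient.
Variables (k : fieldType) (q eps : k) (n : nat).

Lemma free_eval_rel (A : algType k) (v : nat -> A) x y :
  TLB_rel q eps n (gen k n) x y ->
  TLB_rel q eps n v (free_eval v x) (free_eval v y).
Proof.
have evg i : (i < n)%N -> free_eval v (gen k n i) = v i.
  by move=> lti; apply: free_eval_gen; lia.
have ev0 : free_eval v (gen k n 0) = v 0 by apply: free_eval_gen.
case=> [i lti|i j lti ltj ij|i i0 lti|i i0 lti||n1|i lti].
- have := TLB_relUU q eps v lti; rewrite -evg; last by lia.
  by move: (gen _ _ i) => u; rewrite free_evalM free_evalZ.
- have := TLB_relUC q eps v lti ltj ij; rewrite -!evg; [|lia|lia].
  by move: (gen _ _ i) (gen _ _ j) => u w; rewrite !free_evalM.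
- have := TLB_relUSU q eps v i0 lti; rewrite -!evg; [|lia|lia].
  by move: (gen _ _ i) (gen _ _ i.+1) => u w; rewrite !free_evalM.
- have := TLB_relSUS q eps v i0 lti; rewrite -!evg; [|lia|lia].
  by move: (gen _ _ i) (gen _ _ i.+1) => u w; rewrite !free_evalM.
- have := TLB_relss q eps n v; rewrite -ev0 -(free_eval1 n v).
  by move: (gen _ _ 0) => u; rewrite free_evalM.
- have := TLB_relUsU q eps v n1; rewrite -ev0 -evg // -(free_eval0 n v).
  by move: (gen _ _ 0) (gen _ _ 1) => u w; rewrite !free_evalM.
- have := TLB_relsC q eps v lti; rewrite -ev0 -evg; last by lia.
  by move: (gen _ _ 0) (gen _ _ i) => u w; rewrite !free_evalM.
Qed.

Lemma free_eval_ideal (A : algType k) (v : nat -> A) :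
  (forall x y, TLB_rel q eps n v x y -> x = y) ->
  forall x : freeTLB k n, TLB_ideal q eps x -> free_eval v x = 0.
Proof.
move=> hv x; elim=> {x} [a b /free_eval_rel r||x y _ hx _ hy|a x b _ hx].
- by rewrite free_evalD free_evalN (hv _ _ (r _ v)) subrr.
- exact: free_eval0.
- by rewrite free_evalD hx hy addr0.
- by rewrite !free_evalM hx mulr0 mul0r.
Qed.

Lemma TLB_nonzero : TLB_pi q eps 1 != TLB_pi q eps (0 : freeTLB k n).
Proof.
apply/eqP => /TLB_piP.
pose v (i : nat) : k^o := (i == 0)%:R.
rewrite subr0 => /(@free_eval_ideal k^o v) h.
have v0 i : (0 < i)%N -> v i = 0 by case: i.
have /eqP : free_eval v (1 : freeTLB k n) = 0.
  apply: h => x y; case=> [i /andP[i0 _]|i j /andP[i0 _] /andP[j0 _] _|i i0 _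
    |i i0 _||_|i /andP[/ltnW i0 _]].
  - by rewrite v0 // mulr0 scaler0.
  - by rewrite (v0 i) // (v0 j).
  - by rewrite (v0 i) // mulr0.
  - by rewrite (v0 i.+1) // mulr0.
  - by rewrite /v mulr1.
  - by rewrite (v0 1%N) // mulr0.
  - by rewrite (v0 i) // mulr0 mul0r.
by rewrite free_eval1 oner_eq0.
Qed.

HB.instance Definition _ := GRing.Zmodule_isNzRing.Build (TLB q eps n)
  (@TLB_mulA k q eps n) (@TLB_mul1l k q eps n) (@TLB_mul1r k q eps n)
  (@TLB_mulDl k q eps n) (@TLB_mulDr k q eps n) TLB_nonzero.

Local Notation pi := (@TLB_pi k q eps n).
Local Notation TLB_scale := (@TLB_scale k q eps n).

Lemma TLB_piD a b : pi (a + b) = pi a + pi b.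
Proof. by rewrite -TLB_pi_add. Qed.

Lemma TLB_piM a b : pi (a * b) = pi a * pi b.
Proof. by rewrite -TLB_pi_mul. Qed.

Lemma TLB_scaleA a b x : TLB_scale a (TLB_scale b x) = TLB_scale (a * b) x.
Proof. by elim/TLB_piW: x => x; rewrite !TLB_pi_scale scalerA. Qed.

Lemma TLB_scale1 : left_id 1 TLB_scale.
Proof. by elim/TLB_piW=> x; rewrite TLB_pi_scale scale1r. Qed.

Lemma TLB_scaleDr : right_distributive TLB_scale +%R.
Proof.
move=> c; elim/TLB_piW=> x; elim/TLB_piW=> y.
by rewrite -TLB_piD !TLB_pi_scale -TLB_piD scalerDr.
Qed.

Lemma TLB_scaleDl x : {morph TLB_scale^~ x : a b / a + b}.
Proof.
by elim/TLB_piW: x => x a b; rewrite !TLB_pi_scale -TLB_piD scalerDl.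
Qed.

HB.instance Definition _ := GRing.Zmodule_isLmodule.Build k (TLB q eps n)
  TLB_scaleA TLB_scale1 TLB_scaleDr TLB_scaleDl.

Lemma TLB_piZ c a : pi (c *: a) = c *: pi a.
Proof. by rewrite -TLB_pi_scale. Qed.

Lemma TLB_scalerAl (c : k) (x y : TLB q eps n) : c *: (x * y) = c *: x * y.
Proof.
elim/TLB_piW: x => x; elim/TLB_piW: y => y.
by rewrite -TLB_piM -!TLB_piZ -TLB_piM scalerAl.
Qed.

HB.instance Definition _ :=
  GRing.Lmodule_isLalgebra.Build k (TLB q eps n) TLB_scalerAl.

Lemma malg_scalerAr (c : k) (x y : freeTLB k n) : c *: (x * y) = x * (c *: y).
Proof.
have com (z : freeTLB k n) : z * c%:MP = c *: z.
  rewrite malgM_def malgZ_def fgmulgU; apply: eq_bigr => w _.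
  by rewrite mulm1 mulrC.
by rewrite -[in RHS]mul_malgC mulrA com scalerAl.
Qed.

Lemma TLB_scalerAr (c : k) (x y : TLB q eps n) : c *: (x * y) = x * (c *: y).
Proof.
elim/TLB_piW: x => x; elim/TLB_piW: y => y.
by rewrite -TLB_piM -!TLB_piZ -TLB_piM malg_scalerAr.
Qed.

HB.instance Definition _ :=
  GRing.Lalgebra_isAlgebra.Build k (TLB q eps n) TLB_scalerAr.

End Quotient.

HB.lock Definition TLB_gen (k : fieldType) (q eps : k) (n i : nat) : TLB q eps n :=
  TLB_pi q eps (gen k n i).

Section Lift.
Variables (k : fieldType) (q eps : k).
Implicit Types n : nat.

Local Notation TLB_gen := (TLB_gen q eps).

Lemma TLB_gen_rel n x y : TLB_rel q eps n (TLB_gen n) x y -> x = y.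
Proof.
have pi_rel a b : TLB_rel q eps n (gen k n) a b ->
    TLB_pi q eps a = TLB_pi q eps b.
  by move=> r; apply/TLB_piP; apply: TLB_ideal_rel.
case=> *; rewrite unlock -?TLB_piM -?TLB_piZ; apply: pi_rel.
- exact: TLB_relUU.
- exact: TLB_relUC.
- exact: TLB_relUSU.
- exact: TLB_relSUS.
- exact: TLB_relss.
- exact: TLB_relUsU.
- exact: TLB_relsC.
Qed.

(* The universal property of TL(B_n): TLB_lift v is the algebra morphism
   mapping the generators to v, provided v satisfies the relations. *)
Section UniversalProperty.
Variables (n : nat) (A : algType k) (v : nat -> A).

Definition TLB_lift (x : TLB q eps n) : A := free_eval v (repr x).

Hypothesis v_rel : forall x y, TLB_rel q eps n v x y -> x = y.

Lemma TLB_lift_pi a : TLB_lift (TLB_pi q eps a) = free_eval v a.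
Proof.
apply/eqP; rewrite -subr_eq0 -free_evalN -free_evalD; apply/eqP.
exact/(free_eval_ideal v_rel)/TLB_ideal_repr.
Qed.

Lemma TLB_liftD : {morph TLB_lift : x y / x + y}.
Proof.
elim/TLB_piW=> x; elim/TLB_piW=> y.
by rewrite -TLB_piD !TLB_lift_pi free_evalD.
Qed.

Lemma TLB_liftM : {morph TLB_lift : x y / x * y}.
Proof.
elim/TLB_piW=> x; elim/TLB_piW=> y.
by rewrite -TLB_piM !TLB_lift_pi free_evalM.
Qed.

Lemma TLB_liftZ c : {morph TLB_lift : x / c *: x}.
Proof.
by elim/TLB_piW=> x; rewrite -TLB_piZ !TLB_lift_pi free_evalZ.
Qed.

Lemma TLB_lift1 : TLB_lift 1 = 1.
Proof. by rewrite (TLB_lift_pi 1) free_eval1. Qed.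

Lemma TLB_lift_gen i : (i < n.-1.+1)%N -> TLB_lift (TLB_gen n i) = v i.
Proof. by move=> lti; rewrite unlock TLB_lift_pi free_eval_gen. Qed.

End UniversalProperty.

Lemma TLB_gen_relS n x y : TLB_rel q eps n (TLB_gen n.+1) x y -> x = y.
Proof.
move=> r; apply: TLB_gen_rel; case: r => *.
- by apply: TLB_relUU; lia.
- by apply: TLB_relUC; lia.
- by apply: TLB_relUSU; lia.
- by apply: TLB_relSUS; lia.
- exact: TLB_relss.
- by apply: TLB_relUsU; lia.
- by apply: TLB_relsC; lia.
Qed.

(* The map TL(B_n) -> TL(B_(n+1)) sending each generator to the generator of
   the same name. *)
Definition TLB_incl n : TLB q eps n -> TLB q eps n.+1 := TLB_lift (TLB_gen n.+1).

Lemma TLB_incl_gen n i :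
  (i < n.-1.+1)%N -> TLB_incl (TLB_gen n i) = TLB_gen n.+1 i.
Proof. by move=> lti; apply: TLB_lift_gen => //; apply: TLB_gen_relS. Qed.

Lemma TLB_incl_is_zmod_morphism n : zmod_morphism (@TLB_incl n).
Proof.
have relS := @TLB_gen_relS n.
move=> x y; rewrite /TLB_incl TLB_liftD // -scaleN1r TLB_liftZ //.
by rewrite scaleN1r.
Qed.

Lemma TLB_incl_is_monoid_morphism n : monoid_morphism (@TLB_incl n).
Proof.
have relS := @TLB_gen_relS n.
by split=> [|x y]; [apply: TLB_lift1 | apply: TLB_liftM].
Qed.

Lemma TLB_incl_is_scalable n : scalable (@TLB_incl n).
Proof.
by move=> c x; apply: TLB_liftZ; apply: TLB_gen_relS.
Qed.

HB.instance Definition _ n := GRing.isZmodMorphism.Build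
  (TLB q eps n) (TLB q eps n.+1) (@TLB_incl n) (@TLB_incl_is_zmod_morphism n).
HB.instance Definition _ n := GRing.isMonoidMorphism.Build
  (TLB q eps n) (TLB q eps n.+1) (@TLB_incl n) (@TLB_incl_is_monoid_morphism n).
HB.instance Definition _ n := GRing.isScalable.Build
  k (TLB q eps n) (TLB q eps n.+1) *:%R (@TLB_incl n) (@TLB_incl_is_scalable n).

Definition TL_s0 n : TLB q eps n := TLB_gen n 0.

(* TL_U n 0 is U_0 = s_0 U_1 s_0; TL_U n i is meaningful for i < n and
   2 <= n only. *)
Definition TL_U n (i : nat) : TLB q eps n :=
  if i == 0%N then TL_s0 n * TLB_gen n 1 * TL_s0 n else TLB_gen n i.

(* membership in the unital subalgebra TL(D_n) of TL(B_n) generated by the U_i;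
   the guard 2 <= n leaves no generator when n = 1 *)
Definition TLD n (x : TLB q eps n) : Prop :=
  forall S : {pred TLB q eps n}, GRing.subalg_closed S ->
    (forall i, (2 <= n)%N -> (i < n)%N -> TL_U n i \in S) -> x \in S.

(* jw_b n eta is b_{n,eta,eps} for n >= 1; jw_b 0 eta is a dummy value. *)
Fixpoint jw_b (n : nat) (eta : k) : TLB q eps n :=
  match n return TLB q eps n with
  | 0 => 0
  | m.+1 =>
    match m return TLB q eps m -> TLB q eps m.+1 with
    | 0 => fun _ => 2^-1 *: (1 + eta *: TL_s0 1)
    | m'.+1 => fun bm =>
        let c := TLB_incl bm in
        c + (eps * ((q ^+ m' + q ^- m') / (q ^+ m'.+1 + q ^- m'.+1))) *:
              (c * TL_U m'.+2 m'.+1 * c)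
    end (jw_b m eta)
  end.

Definition jw_d n : TLB q eps n := jw_b n 1 + jw_b n (-1).

End Lift.

(* Main.v *)
(* Each b_(n,eta) is idempotent, satisfies s_0 b = eta b and is killed by
   U_1, ..., U_(n-1): this is Wenzl's induction, carried by the identity
   U_n b_n U_n = - eps (q^n + q^-n) / (q^(n-1) + q^(1-n)) b_(n-1) U_n. Since the
   eigenvalues of s_0 on b_(n,+) and b_(n,-) differ, these are orthogonal, so
   d_n is idempotent and commutes with s_0; it is then killed by
   U_0 = s_0 U_1 s_0 too. It is nonzero as s_0 |-> 1, U_i |-> 0 maps it to 1.
   If x in TL(D_n) has constant term c and kills the U_i, multiplying it by d_n,
   whose constant term is 1, gives x = x d_n = c d_n, and c = 1 when x is a
   nonzero idempotent. *)
Require Import Defs.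
From mathcomp Require Import all_boot all_algebra.
From mathcomp Require Import reals.
From mathcomp Require Import boolp complex fraction zify ring.

Set Implicit Arguments.
Unset Strict Implicit.
Unset Printing Implicit Defensive.

Import GRing.Theory.
Local Open Scope ring_scope.

(** * One Wenzl step: [a], [b], [b'] model three consecutive projectors and [u] the new generator *)

Section WenzlStep.
Variables (k : fieldType) (A : algType k) (c : k) (a b u : A).
Hypotheses (bb : b * b = b) (ab : a * b = b) (ba : b * a = b).
Hypotheses (au : a * u = u * a) (ubu : u * b * u = - c^-1 *: (a * u)).
Hypothesis c0 : c != 0.

Local Notation b' := (b + c *: (b * u * b)).

Lemma wenzl_absorbr : b' * b = b'.
Proof. by rewrite mulrDl -scalerAl -!mulrA !bb. Qed.

Lemma wenzl_absorbl : b * b' = b'.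
Proof. by rewrite mulrDr -scalerAr !mulrA !bb. Qed.

(** The scalar in [ubu] is chosen so that [c *: (u * b * u * b)] equals [- (a * u * b)]; moving [a]
    past [u] and absorbing it into [b] leaves [- (u * b)]. *)
Lemma wenzl_killl : u * b' = 0.
Proof.
rewrite mulrDr -scalerAr !mulrA ubu -scalerAl scalerA mulrN divff //.
by rewrite scaleN1r au -mulrA ab subrr.
Qed.

Lemma wenzl_killr : b' * u = 0.
Proof.
rewrite mulrDl -scalerAl -!mulrA (mulrA u) ubu -scalerAr scalerA mulrN divff //.
by rewrite scaleN1r mulrA ba subrr.
Qed.

(** In the right factor, [b] is absorbed by [b'], and the correction term contributes [b' * u * b],
    which vanishes. *)
Lemma wenzl_idem : b' * b' = b'.
Proof.
by rewrite mulrDr wenzl_absorbr -scalerAr !mulrA wenzl_absorbr wenzl_killr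
  mul0r scaler0 addr0.
Qed.

End WenzlStep.

(** * Type B projectors in an arbitrary algebra satisfying the relations *)

Section JonesWenzl.
Variables (k : fieldType) (q eps eta : k) (n : nat).
Variables (A : algType k) (v : nat -> A).
Hypothesis v_rel : forall x y, TLB_rel q eps n v x y -> x = y.
Hypotheses (q_neq0 : q != 0) (eps2 : eps * eps = 1) (eta2 : eta * eta = 1).
Hypothesis qD_neq0 : forall m, q ^+ m + q ^- m != 0.

Definition jw_coef m : k := (q ^+ m + q ^- m) / (q ^+ m.+1 + q ^- m.+1).

(* The recursion of [jw_b] inside one fixed algebra, with [jw_proj 0 = 1] so that
   the Wenzl recursion [U_m b_m U_m ~ b_(m-1) U_m] also holds for m = 1. *)
Fixpoint jw_proj (m : nat) : A :=
  if m isn't m1.+1 then 1 else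
  if m1 isn't m2.+1 then 2^-1 *: (1 + eta *: v 0) else
  jw_proj m1 + (eps * jw_coef m2) *: (jw_proj m1 * v m1 * jw_proj m1).

Lemma jw_projSS m : jw_proj m.+2 =
  jw_proj m.+1 + (eps * jw_coef m) *: (jw_proj m.+1 * v m.+1 * jw_proj m.+1).
Proof. by []. Qed.

(** This is [qD_neq0] at exponent 0. *)
Lemma two_neq0 : 2 != 0 :> k.
Proof. by have := qD_neq0 0; rewrite expr0 invr1. Qed.

Lemma eps_neq0 : eps != 0.
Proof. by apply/eqP => e0; move/eqP: eps2; rewrite e0 mul0r eq_sym oner_eq0. Qed.

Lemma eps_inv : eps^-1 = eps.
Proof. by rewrite -[RHS](mulfK eps_neq0) eps2 mul1r. Qed.

Lemma jw_coef_neq0 m : eps * jw_coef m != 0.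
Proof. by rewrite !mulf_neq0 ?invr_eq0 ?eps_neq0. Qed.

(** The Chebyshev-type recurrence [rec] for $q^m+q^{-m}$, divided by $q^{m+1}+q^{-(m+1)}$. It
    carries the scalar of [ubu] from one step to the next. *)
Lemma jw_coefS m :
  - (eps * (q + q^-1)) + eps * jw_coef m = - (eps * jw_coef m.+1)^-1.
Proof.
have rec : q ^+ m.+2 + q ^- m.+2 =
    (q + q^-1) * (q ^+ m.+1 + q ^- m.+1) - (q ^+ m + q ^- m).
  have qm : q ^+ m != 0 by rewrite expf_neq0.
  by rewrite !exprS; field; rewrite qm q_neq0.
rewrite invfM eps_inv /jw_coef invfM invrK rec; have := qD_neq0 m.+1.
move: (q ^+ m + _) (_ + q ^- m.+1) => x y y0.
by rewrite mulrBr (mulrC y^-1) mulfK // (mulrC y^-1) mulrBr opprB addrC.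
Qed.

(** Only [v i] with [i < m] occur in [jw_proj m], and each of them commutes with [v j]. *)
Lemma jw_proj_comm m j : (m < j < n)%N -> jw_proj m * v j = v j * jw_proj m.
Proof.
elim: m => [|[|m] IHm] /andP[mj jn]; first by rewrite mul1r mulr1.
  rewrite /= -scalerAl -scalerAr mulrDl mulrDr mul1r mulr1 -scalerAl -scalerAr.
  by rewrite (v_rel (TLB_relsC q eps v (i := j) _)) ?mj.
have IH := IHm _; rewrite jw_projSS mulrDl mulrDr -scalerAl -scalerAr.
have vv : v m.+1 * v j = v j * v m.+1.
  by apply: v_rel; apply: TLB_relUC; lia.
rewrite -!mulrA IH ?mulrA; last lia.
rewrite -(mulrA _ (v m.+1)) vv !mulrA IH //; lia.
Qed.

(** The induction starts from $s(1+\eta s)=\eta(1+\eta s)$; afterwards both summands of the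
    recursion begin and end with the previous projector. *)
Lemma jw_proj_s0 m : (0 < m)%N ->
  v 0 * jw_proj m = eta *: jw_proj m /\ jw_proj m * v 0 = eta *: jw_proj m.
Proof.
have ss : v 0 * v 0 = 1 by apply: v_rel; exact: TLB_relss.
case: m => // m _; elim: m => [|m [IHl IHr]].
  rewrite /= -scalerAl -scalerAr mulrDr mulrDl mulr1 mul1r -scalerAl -scalerAr.
  have -> : v 0 + eta *: (v 0 * v 0) = eta *: (1 + eta *: v 0).
    by rewrite ss scalerDr scalerA eta2 scale1r addrC.
  by rewrite !scalerA mulrC.
rewrite jw_projSS mulrDr mulrDl -scalerAl -scalerAr !mulrA IHl -!mulrA IHr.
by rewrite -!scalerAl -!scalerAr scalerDr !scalerA mulrC.
Qed.

(** The four facts are exactly what one Wenzl step consumes, so they are proved together. *)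
Lemma jw_proj_spec m : (m < n)%N ->
  [/\ jw_proj m.+1 * jw_proj m.+1 = jw_proj m.+1,
      jw_proj m * jw_proj m.+1 = jw_proj m.+1,
      jw_proj m.+1 * jw_proj m = jw_proj m.+1 &
      (m.+1 < n)%N -> v m.+1 * jw_proj m.+1 * v m.+1 =
         - (eps * jw_coef m)^-1 *: (jw_proj m * v m.+1)].
Proof.
elim: m => [|m IHm] mn.
  split; rewrite /= ?mul1r ?mulr1 //; last first.
    (* Since $U_1s_0U_1=0$, half the loop value remains, and [jw_coef 0] is $2/(q+q^{-1})$. *)
    move=> n1; rewrite -scalerAr -scalerAl mulrDr mulrDl mulr1 -scalerAr -scalerAl.
    have -> : v 1 * v 0 * v 1 = 0 by apply: v_rel; apply: TLB_relUsU.
    rewrite scaler0 addr0 (v_rel (TLB_relUU q eps v (i := 1) _)) //.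
    rewrite scalerA /jw_coef !expr0 !expr1 invr1 !invfM !invrK eps_inv.
    by congr (_ *: _); rewrite -[1 + 1]/(2 : k); ring.
  have [sb _] := @jw_proj_s0 1 isT.
  rewrite -/(jw_proj 1) -[X in X * _]/(2^-1 *: (1 + eta *: v 0)).
  rewrite -scalerAl mulrDl mul1r -scalerAl sb scalerA eta2 scale1r.
  by rewrite -mulr2n -scaler_nat scalerA mulVf ?two_neq0 ?scale1r.
have [bb ab ba ubu] := IHm (ltnW mn); have {}ubu := ubu mn.
have au := @jw_proj_comm m m.+1 _; have {}au := au ltac:(lia).
rewrite jw_projSS; split.
- exact: (wenzl_idem bb ba ubu (jw_coef_neq0 m)).
- exact: wenzl_absorbl.
- exact: wenzl_absorbr.
move=> mn1; set b := jw_proj m.+1 in bb ab ba ubu *.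
have bw : b * v m.+2 = v m.+2 * b by apply: jw_proj_comm; lia.
have ww : v m.+2 * v m.+2 = - (eps * (q + q^-1)) *: v m.+2.
  by apply: v_rel; apply: TLB_relUU; lia.
have wuw : v m.+2 * v m.+1 * v m.+2 = v m.+2.
  by apply: v_rel; apply: TLB_relSUS.
(* The two parts of the scalar match the two terms of the projector: the first gives the loop value
   by [ww], the second reduces to [b * v m.+2] by [wuw] and [bb]. *)
rewrite -jw_coefS scalerDl mulrDr mulrDl -bw -mulrA ww -scalerAr.
congr (_ + _); rewrite -scalerAr -scalerAl; congr (_ *: _).
rewrite !mulrA -bw -!mulrA bw (mulrA (v m.+1)) !(mulrA (v m.+2)) wuw.
by rewrite -bw mulrA bb.
Qed.

(** The newest generator is killed by the Wenzl step; older ones are already killed by the outer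
    factors of the recursion. *)
Lemma jw_proj_kill m i : (0 < i < m)%N -> (m <= n)%N ->
  v i * jw_proj m = 0 /\ jw_proj m * v i = 0.
Proof.
case: m => [|m]; first lia.
elim: m => [|m IHm] im mn; first lia.
have [bb ab ba ubu] := jw_proj_spec (ltnW mn); have {}ubu := ubu mn.
have [->|im1] := eqVneq i m.+1.
  split; last exact: (wenzl_killr ba ubu (jw_coef_neq0 m)).
  by apply: (wenzl_killl ab _ ubu (jw_coef_neq0 m)); apply: jw_proj_comm; lia.
have [||kl kr] := IHm; [lia|lia|].
rewrite jw_projSS mulrDr mulrDl -scalerAl -scalerAr !mulrA kl -!mulrA kr.
by rewrite !(mul0r, mulr0, scaler0, addr0).
Qed.

End JonesWenzl.

(** * The type D projector and the subalgebra TL(D_n) *)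

Section TypeD.
Variables (k : fieldType) (q eps : k).

Local Notation TLB := (TLB q eps).
Local Notation TLB_gen := (TLB_gen q eps).
Local Notation TLB_incl := (@TLB_incl k q eps _).
Local Notation TL_s0 := (TL_s0 q eps).
Local Notation TL_U := (TL_U q eps).
Local Notation jw_b := (jw_b q eps).
Local Notation jw_d := (jw_d q eps).

Lemma TLB_incl_jw_proj eta n m : (m <= n)%N ->
  TLB_incl (jw_proj q eps eta (TLB_gen n) m) =
  jw_proj q eps eta (TLB_gen n.+1) m.
Proof.
elim: m => [|[|m] IHm] mn; first exact: rmorph1.
  by rewrite /= linearZ linearD linearZ rmorph1 /= TLB_incl_gen.
rewrite !jw_projSS linearD linearZ !rmorphM /= IHm ?TLB_incl_gen //; lia.
Qed.

Lemma jw_b_proj eta n : (0 < n)%N ->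
  jw_b n eta = jw_proj q eps eta (TLB_gen n) n.
Proof.
case: n => // n _; elim: n => [|n IHn] //.
have -> : jw_b n.+2 eta = TLB_incl (jw_b n.+1 eta) +
    (eps * jw_coef q n) *:
    (TLB_incl (jw_b n.+1 eta) * TL_U n.+2 n.+1 * TLB_incl (jw_b n.+1 eta)).
  by [].
by rewrite IHn TLB_incl_jw_proj.
Qed.

Lemma TL_s0K n : TL_s0 n * TL_s0 n = 1.
Proof. by apply: TLB_gen_rel; exact: TLB_relss. Qed.

Lemma TLD_lin n c (x y : TLB n) : TLD x -> TLD y -> TLD (c *: x + y).
Proof.
by move=> dx dy S hS hU; have [_ lin _] := hS; apply: lin; [exact: dx|exact: dy].
Qed.

Lemma TLD_mul n (x y : TLB n) : TLD x -> TLD y -> TLD (x * y).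
Proof.
by move=> dx dy S hS hU; have [_ _ mul] := hS; apply: mul; [exact: dx|exact: dy].
Qed.

Lemma TLD1 n : TLD (1 : TLB n).
Proof. by move=> S [S1 _ _] _. Qed.

Lemma TLD0 n : TLD (0 : TLB n).
Proof. by rewrite -(subrr 1) addrC -scaleN1r; apply: TLD_lin; apply: TLD1. Qed.

Lemma TLD_scale n c (x : TLB n) : TLD x -> TLD (c *: x).
Proof. by move=> dx; rewrite -[_ *: _]addr0; apply/TLD_lin/TLD0. Qed.

Lemma TLD_add n (x y : TLB n) : TLD x -> TLD y -> TLD (x + y).
Proof. by move=> dx dy; rewrite -[x]scale1r; apply: TLD_lin. Qed.

Lemma TLD_U n i : (1 < n)%N -> (i < n)%N -> TLD (TL_U n i).
Proof. by move=> n1 ni S _; exact. Qed.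

(** The preimage of a test subalgebra under the inclusion is again a test subalgebra. *)
Lemma TLD_incl n (x : TLB n) : TLD x -> TLD (TLB_incl x).
Proof.
move=> dx S [S1 lin mul] hU; apply: (dx [pred y | TLB_incl y \in S]).
  split=> [|c y z|y z]; rewrite !inE ?rmorph1 ?linearP ?rmorphM //.
  - exact: lin.
  - exact: mul.
move=> i n1 ni; rewrite inE; suff -> : TLB_incl (TL_U n i) = TL_U n.+1 i.
  by apply: hU; lia.
rewrite /TL_U; case: eqP => _; last by rewrite TLB_incl_gen //; lia.
by rewrite !rmorphM /= !TLB_incl_gen //; lia.
Qed.

(** Conjugation by $s_0$ is an algebra automorphism that swaps $U_0$ and $U_1$ and fixes the other
    $U_i$. *)
Lemma TLD_s0_conj n (x : TLB n) : TLD x -> TLD (TL_s0 n * x * TL_s0 n).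
Proof.
move=> dx S [S1 lin mul] hU; set s := TL_s0 n.
apply: (dx [pred y | s * y * s \in S]).
  split=> [|c y z|y z]; rewrite !inE.
  - by rewrite mulr1 TL_s0K.
  - by rewrite mulrDr mulrDl -scalerAr -scalerAl; exact: lin.
  - move=> hy hz; suff -> : s * (y * z) * s = (s * y * s) * (s * z * s).
      exact: mul.
    by rewrite !mulrA -(mulrA (s * y) s s) TL_s0K mulr1.
move=> i n1 ni; rewrite inE; case: i ni => [|[|i]] ni.
- rewrite /TL_U eqxx !mulrA TL_s0K mul1r -mulrA TL_s0K mulr1.
  exact: (hU 1 n1 n1).
- exact: (hU 0 n1 (ltnW n1)).
- have -> : s * TL_U n i.+2 = TL_U n i.+2 * s.
    by apply: TLB_gen_rel; apply: TLB_relsC.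
  by rewrite -mulrA TL_s0K mulr1; apply: hU.
Qed.

(* Both projectors share the same even part [a], and [jw_d n = a + a]. *)
Lemma jw_b_even_odd n : (0 < n)%N -> exists a c : TLB n,
  [/\ TLD a, TLD c &
      forall eta, eta * eta = 1 -> jw_b n eta = a + eta *: (TL_s0 n * c)].
Proof.
case: n => // n _; elim: n => [|n [a [c [da dc jwE]]]].
  exists (2^-1 *: 1), (2^-1 *: 1); split; [exact/TLD_scale/TLD1..|].
  by move=> eta _; rewrite /= scalerDr -scalerAr mulr1 !scalerA mulrC.
pose s := TL_s0 n.+2; pose u := TL_U n.+2 n.+1; pose e := eps * jw_coef q n.
have du : TLD u by apply: TLD_U.
have {}jwE eta : eta * eta = 1 ->
    TLB_incl (jw_b n.+1 eta) = TLB_incl a + eta *: (s * TLB_incl c).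
  by move=> /jwE ->; rewrite linearD linearZ rmorphM /= TLB_incl_gen.
move: (TLB_incl a) (TLB_incl c) (TLD_incl da) (TLD_incl dc) jwE.
move=> {da dc} {}a {}c da dc jwE.
(* Expand $(a+\eta sc)u(a+\eta sc)$ with $\eta^2=1$ and sort by parity in $\eta$. A factor $s$ is
   pulled out of the odd part, turning $ausc$ into $s(sausc)$. *)
exists (a + e *: (a * u * a + s * (c * u) * s * c)).
exists (c + e *: (c * u * a + s * (a * u) * s * c)).
have dsu x y : TLD x -> TLD y -> TLD (s * (x * u) * s * y).
  by move=> dx dy; apply/TLD_mul/dy/TLD_s0_conj/TLD_mul.
have duu x y : TLD x -> TLD y -> TLD (x * u * y).
  by move=> dx dy; apply/TLD_mul/dy/TLD_mul.
split=> [||eta eta2].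
- by apply/TLD_add/TLD_scale/TLD_add; auto.
- by apply/TLD_add/TLD_scale/TLD_add; auto.
have -> : jw_b n.+2 eta = TLB_incl (jw_b n.+1 eta) +
    e *: (TLB_incl (jw_b n.+1 eta) * u * TLB_incl (jw_b n.+1 eta)) by [].
rewrite jwE //.
rewrite [s * (c + _)]mulrDr -scalerAr [s * (_ + _)]mulrDr.
have -> : s * (s * (a * u) * s * c) = a * u * (s * c).
  by rewrite !mulrA TL_s0K mul1r.
rewrite mulrDl !mulrDr !mulrDl -!scalerAl -!scalerAr -?scalerAl !mulrA.
rewrite !scalerDr !scalerA.
rewrite -(mulrA e eta eta) eta2 mulr1 (mulrC eta e).
by rewrite [LHS](AC (2*(2*2)) ((1*(3*6))*(2*(4*5)))).
Qed.

Lemma TLD_jw_d n : (0 < n)%N -> TLD (jw_d n).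
Proof.
case/jw_b_even_odd => a [c [da _ jwE]].
rewrite /jw_d !jwE ?mulrNN ?mulr1 //.
by rewrite scaleN1r scale1r addrACA subrr addr0; apply: TLD_add.
Qed.

(* For [x = c + (combination of nontrivial words in the U_i)], this [c] is the
   constant term of [x]. *)
Lemma TLD_const n (x : TLB n) : TLD x ->
  exists c : k, forall z : TLB n,
    ((forall i, (1 < n)%N -> (i < n)%N -> z * TL_U n i = 0) -> z * x = c *: z) /\
    ((forall i, (1 < n)%N -> (i < n)%N -> TL_U n i * z = 0) -> x * z = c *: z).
Proof.
pose P y (c : k) := forall z : TLB n,
    ((forall i, (1 < n)%N -> (i < n)%N -> z * TL_U n i = 0) -> z * y = c *: z) /\
    ((forall i, (1 < n)%N -> (i < n)%N -> TL_U n i * z = 0) -> y * z = c *: z).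
(* Elements with a constant term form a subalgebra containing the $U_i$, whose constant term is
   0. *)
move=> dx; suff /asboolP : x \in [pred y | `[< exists c, P y c >]] by [].
apply: dx => [|i n1 ni].
  split=> [|a y z|y z]; rewrite !inE.
  - by apply/asboolP; exists 1 => z; rewrite mulr1 mul1r scale1r.
  - move=> /asboolP[c yc] /asboolP[d zd]; apply/asboolP; exists (a * c + d) => t.
    rewrite mulrDr mulrDl -scalerAr -scalerAl scalerDl -scalerA.
    by have [? ?] := yc t; have [? ?] := zd t; split=> h; congr (_ *: _ + _); auto.
  - move=> /asboolP[c yc] /asboolP[d zd]; apply/asboolP; exists (c * d) => t.
    have [yl yr] := yc t; have [zl zr] := zd t; split=> h.
      by rewrite mulrA yl // -scalerAl zl // scalerA.
    by rewrite -mulrA zr // -scalerAr yr // scalerA mulrC.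
rewrite inE; apply/asboolP; exists 0 => z.
by split=> h; rewrite scale0r h.
Qed.

Definition TLB_aug_val i : k^o := (i == 0%N)%:R.

Lemma TLB_aug_val_rel n x y : TLB_rel q eps n TLB_aug_val x y -> x = y.
Proof.
have v0 i : (0 < i)%N -> TLB_aug_val i = 0 by case: i.
case=> [i /andP[i0 _]|i j /andP[i0 _] /andP[j0 _] _|i i0 _
    |i i0 _||_|i /andP[/ltnW i0 _]].
- by rewrite v0 // mulr0 scaler0.
- by rewrite (v0 i) // (v0 j).
- by rewrite (v0 i) // mulr0.
- by rewrite (v0 i.+1) // mulr0.
- by rewrite /TLB_aug_val mulr1.
- by rewrite (v0 1%N) // mulr0.
- by rewrite (v0 i) // mulr0 mul0r.
Qed.

(** Every correction term contains some $U_i$, sent to 0, so only the initial projector counts: the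
    value is 1 for $\eta=1$ and 0 for $\eta=-1$. *)
Lemma jw_proj_aug eta m :
  jw_proj q eps eta TLB_aug_val m.+1 = 2^-1 * (1 + eta).
Proof.
elim: m => [|m IHm]; first by rewrite /= /TLB_aug_val eqxx /GRing.scale /= mulr1.
by rewrite jw_projSS {2}/TLB_aug_val mulr0 mul0r scaler0 addr0.
Qed.

Lemma TLB_lift_jw_proj (A : algType k) (v : nat -> A) eta n m : (m <= n)%N ->
  (forall x y, TLB_rel q eps n v x y -> x = y) ->
  TLB_lift v (jw_proj q eps eta (TLB_gen n) m) = jw_proj q eps eta v m.
Proof.
move=> + hv; elim: m => [|[|m] IHm] mn; first exact: TLB_lift1.
  by rewrite /= TLB_liftZ // TLB_liftD // TLB_liftZ // TLB_lift1 // TLB_lift_gen.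
rewrite !jw_projSS TLB_liftD // TLB_liftZ // !TLB_liftM // IHm ?TLB_lift_gen //.
all: lia.
Qed.

Lemma jw_d_neq0 n : (2 : k) != 0 -> (0 < n)%N -> jw_d n <> 0.
Proof.
move=> two0; case: n => // n _ d0.
have rel := @TLB_aug_val_rel n.+1.
have : TLB_lift TLB_aug_val (jw_d n.+1) = 1.
  rewrite /jw_d !jw_b_proj // TLB_liftD // !TLB_lift_jw_proj // !jw_proj_aug.
  by rewrite subrr mulr0 addr0 mulVf.
rewrite d0 -(scale0r (1 : TLB n.+1)) TLB_liftZ // scale0r => /eqP.
by rewrite eq_sym oner_eq0.
Qed.

(** * Idempotence, annihilation and uniqueness *)

Hypotheses (q_neq0 : q != 0) (eps2 : eps * eps = 1).
Hypothesis qD_neq0 : forall m, q ^+ m + q ^- m != 0.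

Lemma jw_b_s0 n eta : (0 < n)%N -> eta * eta = 1 ->
  TL_s0 n * jw_b n eta = eta *: jw_b n eta /\
  jw_b n eta * TL_s0 n = eta *: jw_b n eta.
Proof.
move=> n0 eta2; rewrite jw_b_proj //; apply: jw_proj_s0 => //.
exact: TLB_gen_rel.
Qed.

Lemma jw_d_s0 n : (0 < n)%N -> TL_s0 n * jw_d n = jw_d n * TL_s0 n.
Proof.
move=> n0; rewrite mulrDl mulrDr.
by have [-> ->] := @jw_b_s0 n 1 n0 (mulr1 1);
  have [|-> ->] := @jw_b_s0 n (-1) n0; rewrite ?mulrNN ?mulr1.
Qed.

Lemma jw_d_idem n : (0 < n)%N -> jw_d n * jw_d n = jw_d n.
Proof.
move=> n0; have [h1 h2] : (1 * 1 = 1 :> k) /\ (-1 * -1 = 1 :> k).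
  by rewrite mulrNN mulr1.
have idem eta : eta * eta = 1 -> jw_b n eta * jw_b n eta = jw_b n eta.
  move=> eta2; rewrite jw_b_proj //; case: n n0 => // m _.
  by have [] := jw_proj_spec (@TLB_gen_rel _ _ _ m.+1) q_neq0 eps2 eta2 qD_neq0
    (ltnSn m).
have orth eta : eta * eta = 1 -> jw_b n eta * jw_b n (- eta) = 0.
  move=> eta2; have [_ r] := jw_b_s0 n0 eta2.
  have [|l _] := @jw_b_s0 n (- eta) n0; first by rewrite mulrNN.
  (* Letting $s_0$ act on either neighbour gives opposite multiples of the product, hence $2\eta$
     times it is 0. *)
  have : jw_b n eta * (TL_s0 n * jw_b n (- eta)) =
         jw_b n eta * TL_s0 n * jw_b n (- eta) by rewrite mulrA.
  rewrite l r -scalerAl -scalerAr scaleNr => /esym/eqP.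
  rewrite -subr_eq0 opprK -scalerDl scaler_eq0 => /orP[|/eqP //].
  have eta0 : eta != 0.
    by apply/eqP => e0; move/eqP: eta2; rewrite e0 mul0r eq_sym oner_eq0.
  by rewrite -mulr2n -mulr_natr mulf_eq0 (negPf eta0) (negPf (two_neq0 qD_neq0)).
rewrite /jw_d mulrDl !mulrDr !idem // orth // -{3}(opprK 1) orth //.
by rewrite addr0 add0r.
Qed.

Lemma jw_d_kill n i : (1 < n)%N -> (i < n)%N ->
  jw_d n * TL_U n i = 0 /\ TL_U n i * jw_d n = 0.
Proof.
move=> n1; have n0 := ltnW n1.
have [h1 h2] : (1 * 1 = 1 :> k) /\ (-1 * -1 = 1 :> k).
  by rewrite mulrNN mulr1.
have kill j : (0 < j < n)%N ->
    TLB_gen n j * jw_d n = 0 /\ jw_d n * TLB_gen n j = 0.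
  move=> jn; rewrite /jw_d !jw_b_proj // mulrDl mulrDr.
  have rel := @TLB_gen_rel _ q eps n.
  have [-> ->] := jw_proj_kill rel q_neq0 eps2 h1 qD_neq0 jn (leqnn n).
  have [-> ->] := jw_proj_kill rel q_neq0 eps2 h2 qD_neq0 jn (leqnn n).
  by rewrite addr0.
rewrite /TL_U; case: eqP => [_ _|/eqP i0 ni]; last first.
  by have [|-> ->] := kill i; rewrite ?lt0n ?i0.
have [//|l r] := kill 1%N.
rewrite !mulrA -jw_d_s0 // -!mulrA jw_d_s0 // (mulrA _ (jw_d n) (TL_s0 n)) l.
by rewrite (mulrA (jw_d n)) r !(mul0r, mulr0).
Qed.

Lemma jw_d_unique n (x : TLB n) : (0 < n)%N ->
  TLD x -> x <> 0 -> x * x = x ->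
  (forall i, (1 < n)%N -> (i < n)%N -> x * TL_U n i = 0 /\ 0 = TL_U n i * x) ->
  jw_d n = x.
Proof.
move=> n0 /TLD_const[c xc] x0 xx kill.
have [c' dc] := TLD_const (TLD_jw_d n0).
have d0 := jw_d_neq0 (two_neq0 qD_neq0) n0.
have inj (y : TLB n) a : y <> 0 -> y = a *: y -> a = 1.
  move=> /eqP/negPf y0 /eqP.
  by rewrite -subr_eq0 -[X in X - _]scale1r -scalerBl scaler_eq0 y0 orbF subr_eq0
    => /eqP.
have killd i : (1 < n)%N -> (i < n)%N -> jw_d n * TL_U n i = 0.
  by move=> n1 ni; have [] := jw_d_kill n1 ni.
have killd' i : (1 < n)%N -> (i < n)%N -> TL_U n i * jw_d n = 0.
  by move=> n1 ni; have [] := jw_d_kill n1 ni.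
have c'1 : c' = 1.
  by apply: (inj _ _ d0); have [/(_ killd) <- _] := dc (jw_d n); rewrite jw_d_idem.
have c1 : c = 1.
  apply: (inj _ _ x0); have [h _] := xc x; rewrite -h ?xx // => i n1 ni.
  by have [] := kill i n1 ni.
(* The product [x * jw_d n] equals both [c *: jw_d n] and [c' *: x]. *)
have [_ /(_ killd')] := xc (jw_d n); have [h _] := dc x.
rewrite h ?c1 ?c'1 ?scale1r // => i n1 ni.
by have [] := kill i n1 ni.
Qed.

End TypeD.

(** * Nonvanishing of the denominators in $\mathbb{C}(q)$ *)

Section RationalFunctions.
Variable R : realType.
Local Notation q := (qvar R).

Lemma qvar_neq0 : q != 0.
Proof. by rewrite tofrac_eq0 polyX_eq0. Qed.

(** Multiplying by $q^m$ gives the polynomial $q^{2m}+1$, whose constant coefficient is 2 if $m=0$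
    and 1 otherwise. *)
Lemma qvarD_neq0 m : q ^+ m + q ^- m != 0.
Proof.
have qm : q ^+ m != 0 by rewrite expf_neq0 ?qvar_neq0.
have : q ^+ (m + m) + 1 != 0.
  rewrite -tofracXn -tofrac1 -tofracD tofrac_eq0; apply/eqP.
  case: m {qm} => [|m] /(congr1 (fun p : {poly R[i]} => p`_0)).
    by rewrite coefD expr0 coef1 coef0 => /eqP; rewrite -mulr2n Num.Theory.pnatr_eq0.
  by rewrite coefD coefXn coef1 coef0 add0r => /eqP; rewrite oner_eq0.
apply: contra => /eqP/(congr1 ( *%R (q ^+ m))).
by rewrite mulrDr -exprD divff // mulr0 => ->.
Qed.

End RationalFunctions.

Theorem corollary5p11 (R : realType) (eps : Cq R) (n : nat)
    (heps : eps = 1 \/ eps = -1) (hn : (1 <= n)%N) :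
  unique
    (fun x : TLB (qvar R) eps n =>
       [/\ TLD x,
           x <> 0,
           x * x = x,
           TL_s0 (qvar R) eps n * x * TL_s0 (qvar R) eps n = x &
           forall i : nat, (2 <= n)%N -> (i < n)%N ->
             x * TL_U (qvar R) eps n i = 0 /\ 0 = TL_U (qvar R) eps n i * x])
    (jw_d (qvar R) eps n).
Proof.
have eps2 : eps * eps = 1 by case: heps => ->; rewrite ?mulrNN mulr1.
have [q0 qD0] := (qvar_neq0 R, @qvarD_neq0 R).
split; last by move=> x [dx x0 xx _ kill]; apply: jw_d_unique.
split.
- exact: TLD_jw_d.
- exact: jw_d_neq0 (two_neq0 qD0) hn.
- exact: jw_d_idem.
- by rewrite jw_d_s0 // -mulrA TL_s0K mulr1.
- by move=> i n1 ni; have [-> ->] := jw_d_kill q0 eps2 qD0 n1 ni.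
Qed.
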